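(* For any integer $n \geq 2$, the cardinality $|\operatorname{Gr}_{2,n}^{\geq 0}(\mathbb{F}_3)|$ is equal to each of the following six expressions: $$\sum_{1 \leq i < j < \ell < m \leq n} 2^{n-i-3} + \sum_{1 \leq i < j < \ell \leq n} 2\cdot 2^{n-i-2} + \sum_{1 \leq i < j \leq n} 2^{n-i-1},$$ $$\sum_{i \geq 1} 2^{n-i-3} \binom{n-i}{3} + \sum_{i \geq 1} 2^{n-i-1} \binom{n-i}{2} + \sum_{i \geq 1} 2^{n-i-1} \binom{n-i}{1},$$ $$\frac{2^{n-4}(n-1)n(n+4)}{3},$$ $$[x^{n-2}]\left(\frac{1-x}{(1-2x)^4}\right),$$ $$[x^{n-2}]\left(-T_{n+4}(x)\right),$$ $$[x^{n-2}t^{n+4}]\left(\frac{-(1-tx)}{1-2tx+t^2}\right).$$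
   Context: $\mathbb{F}_q$ is the finite field with $q$ elements. For $a \in \mathbb{F}_q$, write $a \geq 0$ if $a = x^2$ for some $x \in \mathbb{F}_q$; thus in $\mathbb{F}_3$ the nonnegative elements are $0$ and $1$. $\operatorname{Gr}_{k,n}(\mathbb{F}_q)$ is the set of $k$-dimensional subspaces of $\mathbb{F}_q^n$. For a full rank $k \times n$ matrix $A$, $[A]$ denotes its row span, and for a $k$-element subset $I$ of $[n]=\{1,\dots,n\}$, $\Delta_I(A)$ is the $k \times k$ minor of $A$ using the columns indexed by $I$ (in increasing order). The totally nonnegative finite Grassmannian is $$\operatorname{Gr}_{k,n}^{\geq 0}(\mathbb{F}_q) = \{V \in \operatorname{Gr}_{k,n}(\mathbb{F}_q) : \text{there is a matrix } A \text{ with } [A] = V \text{ and } \Delta_I(A) \geq 0 \text{ for all } k\text{-element } I \subseteq [n]\}.$$ $T_n(x)$ denotes the Chebyshev polynomials of the first kind: $T_0(x) = 1$, $T_1(x) = x$, $T_{n+1}(x) = 2xT_n(x) - T_{n-1}(x)$. $[x^m](f(x))$ denotes the coefficient of $x^m$ in the formal power series (or polynomial) $f(x)$, and $[x^a t^b](f(x,t))$ the coefficient of $x^a t^b$ in the formal power series expansion of $f(x,t)$ in $x$ and $t$. Powers of $2$ are rational numbers (negative exponents are allowed). Binomial coefficients $\binom{a}{b}$ are taken to be $0$ when $a < b$ (including when $a$ is negative), so the sums over $i \geq 1$ are finite. *)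

(* Defs.v *)
From HB Require Import structures.
From mathcomp Require Import all_boot all_order all_algebra.
From mathcomp Require Import boolp classical_sets fsbigop.

Set Implicit Arguments.
Unset Strict Implicit.
Unset Printing Implicit Defensive.

Import GRing.Theory.
Local Open Scope ring_scope.

HB.instance Definition _ (F : finFieldType) (vT : vectType F) :=
  Countable.copy {vspace vT} (can_type (@VectorInternalTheory.vs2mxK F vT)).
HB.instance Definition _ (F : finFieldType) (vT : vectType F) :
  isFinite {vspace vT} := CanIsFinite (@VectorInternalTheory.vs2mxK F vT).

Section FiniteGrassmannian.
Variables (F : finFieldType) (k n : nat).

Definition ff_nonneg (a : F) : bool := [exists x : F, a == x ^+ 2].

Definition Gr : {set {vspace 'rV[F]_n}} := [set V | \dim V == k].

Definition rowspan (A : 'M[F]_(k, n)) : {vspace 'rV[F]_n} :=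
  <<[seq row i A | i <- enum 'I_k]>>%VS.

Definition ksubset := {I : {set 'I_n} | #|I| == k}.

(* [enum_val] lists the elements of a subset of 'I_n in increasing order. *)
Definition kth_elem (I : ksubset) (j : 'I_k) : 'I_n :=
  enum_val (cast_ord (esym (eqP (valP I))) j).

Definition minor (I : ksubset) (A : 'M[F]_(k, n)) : F :=
  \det (colsub (kth_elem I) A).

Definition Gr_nonneg : {set {vspace 'rV[F]_n}} :=
  [set V in Gr | [exists A : 'M[F]_(k, n),
     [&& row_free A, rowspan A == V
       & [forall I : ksubset, ff_nonneg (minor I A)]]]].

End FiniteGrassmannian.

Section Chebyshev.
Variable R : nzRingType.

(* [chebyshev_pair n] is (T_n, T_(n+1)). *)
Fixpoint chebyshev_pair (n : nat) : {poly R} * {poly R} :=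
  if n is m.+1 then
    let: (p, q) := chebyshev_pair m in (q, 2%:R * 'X * q - p)
  else (1, 'X).

Definition chebyshevT (n : nat) : {poly R} := (chebyshev_pair n).1.

Lemma chebyshevT0 : chebyshevT 0 = 1.
Proof. by []. Qed.

Lemma chebyshevT1 : chebyshevT 1 = 'X.
Proof. by []. Qed.

Lemma chebyshevTSS n :
  chebyshevT n.+2 = 2%:R * 'X * chebyshevT n.+1 - chebyshevT n.
Proof. by rewrite /chebyshevT /=; case: (chebyshev_pair n). Qed.

End Chebyshev.

(* Formal power series in one variable. A power series is a unit exactly when
   its constant coefficient is, and [f / g] is then the expansion of the
   quotient. Bivariate series are series in one variable whose coefficients are
   series in the other: R[[x, t]] = R[[x]][[t]]. *)
Record fps (R : Type) := Fps { fps_coef : nat -> R }.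

Lemma fpsP (R : Type) (f g : fps R) :
  (forall n, fps_coef f n = fps_coef g n) -> f = g.
Proof. by case: f g => [f] [g] /= /funext ->. Qed.

HB.instance Definition _ (R : Type) := gen_eqMixin (fps R).
HB.instance Definition _ (R : Type) := gen_choiceMixin (fps R).

Section FpsZmod.
Variable R : zmodType.
Implicit Types f g h : fps R.

Definition fps_zero : fps R := Fps (fun=> 0).
Definition fps_add f g := Fps (fun n => fps_coef f n + fps_coef g n).
Definition fps_opp f := Fps (fun n => - fps_coef f n).

Lemma fps_addA : associative fps_add.
Proof. by move=> f g h; apply: fpsP => n /=; rewrite addrA. Qed.
Lemma fps_addC : commutative fps_add.
Proof. by move=> f g; apply: fpsP => n /=; rewrite addrC. Qed.
Lemma fps_add0 : left_id fps_zero fps_add.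
Proof. by move=> f; apply: fpsP => n /=; rewrite add0r. Qed.
Lemma fps_addN : left_inverse fps_zero fps_opp fps_add.
Proof. by move=> f; apply: fpsP => n /=; rewrite addNr. Qed.

HB.instance Definition _ := GRing.isZmodule.Build (fps R)
  fps_addA fps_addC fps_add0 fps_addN.

End FpsZmod.

Section FpsRing.
Variable R : comNzRingType.
Implicit Types f g h : fps R.

Definition fpsC (c : R) : fps R := Fps (fun n => if n is 0 then c else 0).
Definition fpsX : fps R := Fps (fun n => (n == 1%N)%:R).
Definition fps_mul f g :=
  Fps (fun n => \sum_(i < n.+1) fps_coef f i * fps_coef g (n - i)).

Definition fps_trunc m f : {poly R} := \poly_(i < m.+1) fps_coef f i.

Lemma coef_fps_trunc m f i : (i <= m)%N -> (fps_trunc m f)`_i = fps_coef f i.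
Proof. by move=> le_im; rewrite coef_poly ltnS le_im. Qed.

Lemma fps_mulE m f g n : (n <= m)%N ->
  fps_coef (fps_mul f g) n = (fps_trunc m f * fps_trunc m g)`_n.
Proof.
move=> le_nm; rewrite coefM; apply: eq_bigr => i _.
rewrite !coef_fps_trunc //; first exact: leq_trans (leq_subr _ _) le_nm.
by apply: leq_trans le_nm; rewrite -ltnS.
Qed.

Lemma fps_mulA : associative fps_mul.
Proof.
move=> f g h; apply: fpsP => n.
have truncM u v i : (i <= n)%N ->
    (fps_trunc n (fps_mul u v))`_i = (fps_trunc n u * fps_trunc n v)`_i.
  by move=> le_in; rewrite coef_fps_trunc // (fps_mulE _ _ le_in).
rewrite !(fps_mulE _ _ (leqnn n)).
transitivity ((fps_trunc n f * (fps_trunc n g * fps_trunc n h))`_n).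
  by rewrite !coefM; apply: eq_bigr => i _; rewrite truncM // leq_subr.
rewrite mulrA !coefM; apply: eq_bigr => i _.
by rewrite truncM // -ltnS.
Qed.

Lemma fps_mulC : commutative fps_mul.
Proof.
by move=> f g; apply: fpsP => n; rewrite !(fps_mulE _ _ (leqnn n)) mulrC.
Qed.

Lemma fps_mul1 : left_id (fpsC 1) fps_mul.
Proof.
move=> f; apply: fpsP => n /=; rewrite big_ord_recl /= mul1r subn0.
by rewrite big1 ?addr0 // => i _; rewrite mul0r.
Qed.

Lemma fps_mulDl : left_distributive fps_mul +%R.
Proof.
move=> f g h; apply: fpsP => n /=; rewrite -big_split.
by apply: eq_bigr => i _; rewrite mulrDl.
Qed.

Lemma fps_one_neq0 : fpsC 1 != 0.
Proof.
apply/eqP => /(congr1 (fun f => fps_coef f 0)) /= /eqP.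
by rewrite oner_eq0.
Qed.

HB.instance Definition _ := GRing.Zmodule_isComNzRing.Build (fps R)
  fps_mulA fps_mulC fps_mul1 fps_mulDl fps_one_neq0.

End FpsRing.

Arguments fpsX {R}.

Section FpsInverse.
Variable R : comUnitRingType.
Implicit Types f g : fps R.

(* The first n+1 coefficients of the inverse of f, in reverse order. *)
Fixpoint fps_inv_seq f (n : nat) : seq R :=
  if n is m.+1 then
    let s := fps_inv_seq f m in
    - ((fps_coef f 0)^-1 * \sum_(i < m.+1) fps_coef f i.+1 * s`_i) :: s
  else [:: (fps_coef f 0)^-1].

Definition fps_unit : pred (fps R) := fun f => fps_coef f 0 \is a GRing.unit.

Definition fps_inv f : fps R :=
  if fps_unit f then Fps (fun n => (fps_inv_seq f n)`_0) else f.

Lemma nth_fps_inv_seq f n i : (i <= n)%N ->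
  (fps_inv_seq f n)`_i = (fps_inv_seq f (n - i))`_0.
Proof.
elim: n i => [|n IHn] [|i] //= le_in.
by rewrite IHn // subSS.
Qed.

Lemma fps_mulVf : {in fps_unit, left_inverse 1 fps_inv *%R}.
Proof.
move=> f Uf; rewrite mulrC; apply: fpsP => n.
have Uf0 : fps_coef f 0 \is a GRing.unit by [].
have -> : fps_inv f = Fps (fun n => (fps_inv_seq f n)`_0).
  by rewrite /fps_inv (_ : fps_unit f).
change (\sum_(i < n.+1) fps_coef f i * (fps_inv_seq f (n - i))`_0
  = if n is 0 then 1 else 0).
case: n => [|n]; first by rewrite big_ord1 /= divrr.
rewrite big_ord_recl subn0 /= mulrN mulrA divrr // mul1r.
apply/eqP; rewrite addrC subr_eq0; apply/eqP; apply: eq_bigr => i _.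
by rewrite subSS [in RHS]nth_fps_inv_seq // -ltnS.
Qed.

Lemma fps_unitP f g : g * f = 1 -> fps_unit f.
Proof.
move=> /(congr1 (fun h => fps_coef h 0)) gf1; apply/unitrPr.
exists (fps_coef g 0).
have gf0 : fps_coef (g * f) 0 = fps_coef g 0 * fps_coef f 0 := big_ord1 _ _.
by rewrite mulrC -gf0 gf1.
Qed.

Lemma fps_inv_out : {in [predC fps_unit], fps_inv =1 id}.
Proof.
move=> f nUf; have /negbTE nf : ~~ fps_unit f by [].
by rewrite /fps_inv nf.
Qed.

HB.instance Definition _ := GRing.ComNzRing_hasMulInverse.Build (fps R)
  fps_mulVf fps_unitP fps_inv_out.

End FpsInverse.

(* Coefficient of x^a t^b in R[[x]][[t]]. *)
Definition fps_coef2 (R : Type) (f : fps (fps R)) (a b : nat) : R :=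
  fps_coef (fps_coef f b) a.

Definition fps2_x (R : comNzRingType) : fps (fps R) := fpsC fpsX.
Definition fps2_t (R : comNzRingType) : fps (fps R) := fpsX.

(* Main.v *)
Require Import Defs.
From mathcomp Require Import all_boot all_order all_algebra.
From mathcomp Require Import boolp classical_sets fsbigop.
From mathcomp Require Import ring zify.

(** Over the field with three elements, a nonnegative plane has exactly one
    representative of the following shape. Start from a matrix with nonnegative
    minors, and let i be its first nonzero column and j the first column
    independent of column i. The corresponding minor is nonzero and nonnegative,
    so it is 1, and left multiplication by the inverse of the submatrix on
    columns i and j preserves all minors while turning these two columns into
    e1 and e2. Testing any other column against e1 and e2 leaves only the five
    vectors 0, e1, e2, e2 - e1, -e1; these are the letters 0, 1, 2, 3, 4, and a
    matrix becomes a word. The remaining minors say that the nonzero letters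
    weakly increase along the word ([nonneg_reduced]). Conversely every word with
    weakly increasing nonzero letters, containing both letters 1 and 2, spells a
    matrix with nonnegative minors, and the word is recovered from the row space
    because i and j are intrinsic to it ([word_mx_inj]). Hence the planes are
    counted by such words ([card_Gr_nonneg_reduced]).

    Reading a word from the left, each position is either 0, or repeats the
    current letter, or moves up to a larger one, where the letters 1 and 2 cannot
    be skipped. This gives a linear recursion with one counting sequence for each
    current letter, all of them of the form 2^n times a polynomial in n; the one
    for words not yet begun is the cubic formula ([grass_count]).

    The other expressions are compared with this formula. The sums group the
    words by the position of the first nonzero letter. The power series is
    identified by multiplying back by (1 - 2x)^4. In the Chebyshev polynomials,
    the coefficient of x^k in T_(k+2e) obeys a recursion in k whose
    inhomogeneous term is the same coefficient for e - 1; solving it for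
    e = 0, 1, 2, 3 produces the cubic formula at e = 3. The bivariate series is
    the generating function of the Chebyshev polynomials. *)

Set Implicit Arguments.
Unset Strict Implicit.
Unset Printing Implicit Defensive.

Import GRing.Theory.
Local Open Scope ring_scope.

(** * Row spaces and two-rowed minors *)

Lemma mem_rowspan (F : finFieldType) (k n : nat) (A : 'M[F]_(k, n)) (v : 'rV_n) :
  (v \in rowspan A) = (v <= A)%MS.
Proof.
apply/idP/idP => [|/submxP[u ->]].
  rewrite /rowspan => /(coord_span (X := in_tuple _)) ->.
  apply: summx_sub => i _; apply: scalemx_sub.
  have /mapP[r _ ->] := mem_nth 0 (ltn_ord i).
  exact: row_sub.
rewrite mulmx_sum_row; apply: memv_suml => i _; apply: memvZ.
by apply: memv_span; apply: map_f; rewrite mem_enum.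
Qed.

Lemma rowspan_sub (F : finFieldType) (k n : nat) (A B : 'M[F]_(k, n)) :
  (rowspan A <= rowspan B)%VS = (A <= B)%MS.
Proof.
apply/subvP/idP => [sAB | sAB v]; last first.
  by rewrite !mem_rowspan => /submx_trans; apply.
by apply/row_subP => i; rewrite -mem_rowspan sAB // mem_rowspan row_sub.
Qed.

Lemma dim_rowspan (F : finFieldType) (k n : nat) (A : 'M[F]_(k, n)) :
  row_free A -> \dim (rowspan A) = k.
Proof.
move=> freeA.
have sz : size [seq row i A | i <- enum 'I_k] == k.
  by rewrite size_map size_enum_ord.
suff : free (Tuple sz) by rewrite /free => /eqP ->; apply/eqP.
apply/freeP => u uA0 i.
have /(row_free_inj freeA)/rowP/(_ i) : \row_i u i *m A = 0 *m A.
  rewrite mul0mx mulmx_sum_row -[RHS]uA0; apply: eq_bigr => r _.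
  by rewrite mxE /= (nth_map r) ?size_enum_ord // nth_ord_enum.
by rewrite !mxE.
Qed.

Definition pluecker (F : finFieldType) (n : nat) (A : 'M[F]_(2, n)) (p q : 'I_n) : F :=
  A 0 p * A 1 q - A 0 q * A 1 p.

Lemma minor_pluecker (F : finFieldType) (n : nat) (A : 'M[F]_(2, n)) (I : ksubset 2 n) :
  minor I A = pluecker A (kth_elem I 0) (kth_elem I 1).
Proof.
rewrite /minor (expand_det_row _ 0) !big_ord_recl big_ord0 /cofactor.
rewrite !det_mx11 !mxE /= /pluecker addr0 expr0 expr1 mul1r mulN1r mulrN.
have -> : lift 0 0 = 1 :> 'I_2 by apply: val_inj.
have -> : lift 1 0 = 0 :> 'I_2 by apply: val_inj.
by [].
Qed.

(** A subset is enumerated by filtering the increasing list of all ordinals. *)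
Lemma enum_val_lt (n : nat) (I : {set 'I_n}) (i j : 'I_#|I|) :
  (i < j)%N -> (enum_val i < enum_val j)%N.
Proof.
move=> lt_ij; have x0 : 'I_n := enum_val i.
pose lt : rel 'I_n := fun a b => (a < b)%N.
have tr : transitive lt by move=> a b c; apply: ltn_trans.
have srt : sorted lt (enum I).
  rewrite /enum_mem sorted_filter // -enumT.
  have := iota_ltn_sorted 0 n; rewrite -val_enum_ord sorted_map; exact.
rewrite (enum_val_nth x0 i) (enum_val_nth x0 j).
by apply: (sorted_ltn_nth tr x0 srt); rewrite ?inE -?cardE.
Qed.

(** An increasing pair of columns is the same thing as a two-element set of
    columns together with its increasing enumeration. *)
Lemma minors_pluecker (F : finFieldType) (n : nat) (A : 'M[F]_(2, n)) (P : pred F) :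
  [forall I : ksubset 2 n, P (minor I A)] <->
  (forall p q : 'I_n, (p < q)%N -> P (pluecker A p q)).
Proof.
have lt01 (I : ksubset 2 n) : (kth_elem I 0%R < kth_elem I 1%R)%N.
  exact: enum_val_lt.
split=> [/forallP PI p q lt_pq | PA]; last first.
  by apply/forallP => I; rewrite minor_pluecker PA.
have cI : #|[set p; q]| == 2 by rewrite cards2 neq_ltn lt_pq.
pose I : ksubset 2 n := exist (fun J : {set 'I_n} => #|J| == 2) _ cI.
have := PI I; rewrite minor_pluecker.
move: (lt01 I).
have /set2P[->|->] : kth_elem I 0 \in [set p; q] by exact: enum_valP.
all: have /set2P[->|->] : kth_elem I 1 \in [set p; q] by exact: enum_valP.
all: by rewrite ?ltnn // ltnNge ltnW.
Qed.

Lemma rowspan_factor (F : finFieldType) (k n : nat) (A B : 'M[F]_(k, n)) :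
  rowspan A = rowspan B -> exists D : 'M_k, A = D *m B.
Proof. by move=> AB; apply/submxP; rewrite -rowspan_sub AB. Qed.

Lemma mulmx2E (F : finFieldType) (n : nat) (D : 'M[F]_2) (B : 'M[F]_(2, n)) r q :
  (D *m B) r q = D r 0 * B 0 q + D r 1 * B 1 q.
Proof.
by rewrite mxE big_ord_recl big_ord1; congr (_ + D _ _ * B _ _); apply: val_inj.
Qed.

Lemma pluecker_mulmx (F : finFieldType) (n : nat) (D : 'M[F]_2) (A : 'M[F]_(2, n)) p q :
  pluecker (D *m A) p q = (D 0 0 * D 1 1 - D 0 1 * D 1 0) * pluecker A p q.
Proof. by rewrite /pluecker !mulmx2E; ring. Qed.

(** Both columns exist because no nonzero combination of the rows vanishes: if
    every column were proportional to column i, then the combination of the rows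
    with coefficients - A 1 i and A 0 i would be zero. *)
Lemma first_columns (F : finFieldType) (n : nat) (A : 'M[F]_(2, n)) : row_free A ->
  exists i j : 'I_n, [/\ pluecker A i j != 0,
    forall q : 'I_n, (q < i)%N -> A 0 q = 0 /\ A 1 q = 0
    & forall q : 'I_n, (q < j)%N -> pluecker A i q = 0].
Proof.
move=> freeA.
pose nz (q : 'I_n) := (A 0 q != 0) || (A 1 q != 0).
have nzN q : ~~ nz q -> A 0 q = 0 /\ A 1 q = 0.
  by rewrite negb_or !negbK => /andP[/eqP -> /eqP ->].
have inj (x y : F) : (forall q, x * A 0 q + y * A 1 q = 0) -> x = 0 /\ y = 0.
  move=> xy0; pose u : 'rV[F]_2 := \row_c (if c == 0 then x else y).
  have /(row_free_inj freeA)/rowP u0 : u *m A = 0 *m A.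
    apply/rowP => q; rewrite mul0mx [RHS]mxE -(xy0 q).
    rewrite !mxE big_ord_recl big_ord1 !mxE /=.
    by congr (_ + _ * A _ _); apply: val_inj.
  by have := u0 0; have := u0 1; rewrite !mxE.
have [i0 nz_i0] : exists q, nz q.
  apply/existsP; apply: contraT; rewrite negb_exists => /forallP A0.
  have [|/eqP] := inj 1 0; last by rewrite oner_eq0.
  by move=> q; have [-> ->] := nzN q (A0 q); rewrite !mulr0 addr0.
have [i nz_i mini] := arg_minnP (fun q : 'I_n => q : nat) nz_i0.
have [j0 det_j0] : exists q, pluecker A i q != 0.
  apply/existsP; apply: contraT; rewrite negb_exists => /forallP A0.
  have [|/eqP a1 a0] := inj (- A 1 i) (A 0 i).
    move=> q; have := A0 q; rewrite negbK => /eqP <-; rewrite /pluecker; ring.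
  by move: nz_i; rewrite /nz a0 eqxx /= -oppr_eq0 a1.
have [j det_j minj] := @arg_minnP _ j0 (fun q => pluecker A i q != 0) (fun q => q : nat) det_j0.
exists i, j; split=> // q ltq.
  by apply: nzN; apply: contraL ltq => /mini; rewrite -leqNgt.
by apply/eqP; apply: contraLR ltq => /minj; rewrite -leqNgt.
Qed.

(** * The field with three elements *)

Lemma F3P (x : 'F_3) : [\/ x = 0, x = 1 | x = -1].
Proof.
by case: x => [[|[|[|m]]] lt_m]; [constructor 1 | constructor 2 | constructor 3 | ];
  rewrite //; apply: val_inj.
Qed.

Lemma ff_nonneg_F3 (x : 'F_3) : ff_nonneg x = (x != -1).
Proof.
case: (F3P x) => ->; rewrite /ff_nonneg.
- by apply/existsP; exists 0; rewrite expr0n.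
- by apply/existsP; exists 1; rewrite expr1n.
rewrite eqxx; apply/existsP => -[y].
by case: (F3P y) => ->.
Qed.

(** * Reduced words and the matrices they spell *)

(** The letter 0 stands for the zero column, which may occur anywhere. *)
Definition follows (a b : nat) : bool := (b == 0) || (a <= b)%N.

(** Letters are compared as natural numbers, so the predicate is on sequences of
    naturals; the alphabet itself only appears in [word_count]. *)
Definition reduced_word (s : seq nat) : bool :=
  [&& pairwise follows s, 1%N \in s & 2 \in s].

Definition word_count (P : pred (seq nat)) (n : nat) : nat :=
  #|[set w : n.-tuple 'I_5 | P (map val w)]|.

(** The columns 0, e1, e2, e2 - e1, -e1, listed so that the determinant of two
    nonzero letters a < b is nonnegative. *)
Definition letter_x (a : nat) : 'F_3 := nth 0 [:: 0; 1; 0; -1; -1] a.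
Definition letter_y (a : nat) : 'F_3 := nth 0 [:: 0; 0; 1; 1; 0] a.
Definition word_mx (n : nat) (w : n.-tuple 'I_5) : 'M['F_3]_(2, n) :=
  \matrix_(r, c) (if r == 0 then letter_x else letter_y) (tnth w c).

(** The exception is the pair (-e1, e1), whose determinant vanishes although the
    letters decrease; the presence of e2 rules it out in [nonneg_reduced]. *)
Lemma letter_det (a b : 'I_5) :
  (letter_x a * letter_y b - letter_x b * letter_y a != -1)
    = follows a b || ((a == 4 :> nat) && (b == 1 :> nat)).
Proof. by case: a => [[|[|[|[|[|]]]]] //= _]; case: b => [[|[|[|[|[|]]]]] //= _]. Qed.

Lemma letter_inj (a b : 'I_5) : letter_x a = letter_x b -> letter_y a = letter_y b -> a = b.
Proof.
move=> eqx eqy; apply: val_inj.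
by move: eqx eqy; case: a => [[|[|[|[|[|]]]]] //= _]; case: b => [[|[|[|[|[|]]]]] //= _].
Qed.

(** Here (x, y) is a column standing either before e2, so that it is a multiple of
    e1 with det (_, e2) nonnegative, or after both e1 and e2, so that det (e2, _)
    and det (e1, _) are nonnegative. *)
Lemma letter_exists (x y : 'F_3) : (y == 0) && (x != -1) || (x != 1) && (y != -1) ->
  exists a : 'I_5, letter_x a = x /\ letter_y a = y.
Proof.
case: (F3P x) => ->; case: (F3P y) => -> // _.
- by exists (inord 0); rewrite inordK.
- by exists (inord 2); rewrite inordK.
- by exists (inord 1); rewrite inordK.
- by exists (inord 4); rewrite inordK.
- by exists (inord 3); rewrite inordK.
Qed.

Lemma word_mxE (n : nat) (w : n.-tuple 'I_5) (q : 'I_n) :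
  (word_mx w 0 q = letter_x (tnth w q)) * (word_mx w 1 q = letter_y (tnth w q)).
Proof. by rewrite !mxE. Qed.

Lemma reducedP (n : nat) (w : n.-tuple 'I_5) :
  reduced_word (map val w) <->
  [/\ forall p q : 'I_n, (p < q)%N -> follows (tnth w p) (tnth w q),
      exists i, tnth w i = 1%N :> nat & exists j, tnth w j = 2%N :> nat].
Proof.
have memP (a : nat) : reflect (exists i, tnth w i = a :> nat) (a \in map val w).
  apply: (iffP mapP) => [[b /tnthP[i ->] ->]|[i <-]]; first by exists i.
  by exists (tnth w i) => //; apply: mem_tnth.
have pairP : reflect (forall p q : 'I_n, (p < q)%N -> follows (tnth w p) (tnth w q))
    (pairwise follows (map val w)).
  apply: (iffP (pairwiseP 0%N)) => [fw p q lt_pq | fw p q].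
    have := fw p q; rewrite !inE size_map size_tuple !ltn_ord => /(_ isT isT lt_pq).
    by rewrite !(nth_map ord0) ?size_tuple // -!tnth_nth.
  rewrite !inE !size_map !size_tuple => ltp ltq lt_pq.
  rewrite !(nth_map ord0) ?size_tuple //.
  by have := fw (Ordinal ltp) (Ordinal ltq) lt_pq; rewrite !(tnth_nth ord0).
by split=> [/and3P[/pairP ? /memP ? /memP ?] | [/pairP ? /memP ? /memP ?]];
  [split | apply/and3P].
Qed.

(** These positions depend only on linear relations between columns: i is the
    first nonzero column, and j the first column independent of column i. *)
Definition pivots (n : nat) (w : n.-tuple 'I_5) (i j : 'I_n) : Prop :=
  [/\ tnth w i = 1%N :> nat, tnth w j = 2%N :> nat,
    forall q : 'I_n, (q < i)%N -> tnth w q = 0%N :> nat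
    & forall q : 'I_n, (q < j)%N -> (tnth w q <= 1)%N].

Lemma reduced_pivots (n : nat) (w : n.-tuple 'I_5) : reduced_word (map val w) ->
  exists i j, pivots w i j.
Proof.
move=> /reducedP[fw [i0 wi0] [j0 wj0]].
have [i wi mini] := arg_minnP (fun q : 'I_n => q : nat)
  (introT eqP wi0 : (fun q => tnth w q == 1%N :> nat) i0).
have [j wj minj] := arg_minnP (fun q : 'I_n => q : nat)
  (introT eqP wj0 : (fun q => tnth w q == 2%N :> nat) j0).
exists i, j; split; try exact/eqP.
  move=> q lt_qi; have := fw q i lt_qi; rewrite /follows (eqP wi) /=.
  have := mini q; case: (nat_of_ord (tnth w q)) => [|[|m]] //=.
  by move=> /(_ isT); rewrite leqNgt lt_qi.
move=> q lt_qj; have := fw q j lt_qj; rewrite /follows (eqP wj) /=.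
have := minj q; case: (nat_of_ord (tnth w q)) => [|[|[|m]]] //=.
by move=> /(_ isT); rewrite leqNgt lt_qj.
Qed.

Lemma word_mx_free (n : nat) (w : n.-tuple 'I_5) :
  reduced_word (map val w) -> row_free (word_mx w).
Proof.
move=> /reducedP[_ [i wi] [j wj]]; apply: inj_row_free => v /rowP vA.
have col q : v 0 0 * letter_x (tnth w q) + v 0 1 * letter_y (tnth w q) = 0.
  have := vA q; rewrite !mxE big_ord_recl big_ord1 !mxE /= => <-.
  by congr (_ + v _ _ * _); apply: val_inj.
apply/rowP => r; rewrite mxE.
have v0 : v 0 0 = 0 by have := col i; rewrite wi mulr1 mulr0 addr0.
have v1 : v 0 1 = 0 by have := col j; rewrite wj mulr1 mulr0 add0r.
by case: r => [[|[|r]] lt_r] //; [rewrite -[RHS]v0 | rewrite -[RHS]v1];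
  congr (v _ _); apply: val_inj.
Qed.

Lemma pluecker_word (n : nat) (w : n.-tuple 'I_5) (p q : 'I_n) :
  pluecker (word_mx w) p q =
    letter_x (tnth w p) * letter_y (tnth w q) - letter_x (tnth w q) * letter_y (tnth w p).
Proof. by rewrite /pluecker !word_mxE. Qed.

Lemma rowspan_word_nonneg (n : nat) (w : n.-tuple 'I_5) :
  reduced_word (map val w) -> rowspan (word_mx w) \in Gr_nonneg 'F_3 2 n.
Proof.
move=> cw; have free := word_mx_free cw; have [fw _ _] := (reducedP w).1 cw.
rewrite !inE dim_rowspan // eqxx /=; apply/existsP; exists (word_mx w).
rewrite free eqxx /=.
apply/(minors_pluecker (word_mx w) (@ff_nonneg _)) => p q lt_pq.
by rewrite ff_nonneg_F3 pluecker_word letter_det fw.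
Qed.

(** * Nonnegative planes correspond to reduced words *)

(** A matrix D sends zero columns to zero columns, and columns proportional to e1
    to columns proportional to e1 once column i shows that it fixes e1. So the
    pivots of D *m word_mx v cannot come before those of v. *)
Lemma pivots_le (n : nat) (w v : n.-tuple 'I_5) (D : 'M_2) (i j i' j' : 'I_n) :
  word_mx w = D *m word_mx v -> pivots w i j -> pivots v i' j' ->
  (i' <= i)%N /\ (i' = i -> (j' <= j)%N).
Proof.
move=> /matrixP wDv [wi wj _ _] [vi' vj' v0 v1].
have Ew r q : word_mx w r q = D r 0 * letter_x (tnth v q) + D r 1 * letter_y (tnth v q).
  by rewrite wDv mulmx2E !word_mxE.
split=> [|eq_i].
  rewrite leqNgt; apply/negP => /v0 vi.
  by have := Ew 0 i; rewrite word_mxE wi vi !mulr0 addr0.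
rewrite leqNgt; apply/negP => /v1 vj.
have D10 : D 1 0 = 0.
  by have := Ew 1 i; rewrite word_mxE wi -eq_i vi' mulr1 mulr0 addr0.
have := Ew 1 j; rewrite word_mxE wj D10 mul0r add0r.
by move: vj; case: (nat_of_ord _) => [|[|m]] //= _; rewrite mulr0.
Qed.

(** The change of basis between the two matrices works in both directions, so the
    words share their pivots; it then fixes e1 and e2 and is the identity. *)
Lemma word_mx_inj (n : nat) (w v : n.-tuple 'I_5) :
  reduced_word (map val w) -> reduced_word (map val v) ->
  rowspan (word_mx w) = rowspan (word_mx v) -> w = v.
Proof.
move=> /reduced_pivots[i [j pw]] /reduced_pivots[i' [j' pv]] eq_wv.
have [D wDv] := rowspan_factor eq_wv; have [D' vDw] := rowspan_factor (esym eq_wv).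
have [le_i'i le_j'j] := pivots_le wDv pw pv.
have [le_ii' le_jj'] := pivots_le vDw pv pw.
have ei : i' = i by apply: val_inj; apply/eqP; rewrite eqn_leq le_i'i.
have ej : j' = j by apply: val_inj; apply/eqP; rewrite eqn_leq le_j'j ?le_jj'.
subst i' j'; case: pw pv => [wi wj _ _] [vi vj _ _].
have Ew r q : word_mx w r q = D r 0 * letter_x (tnth v q) + D r 1 * letter_y (tnth v q).
  by rewrite wDv mulmx2E !word_mxE.
have D1 : D = 1%:M.
  have := Ew 0 i; have := Ew 1 i; have := Ew 0 j; have := Ew 1 j.
  rewrite !word_mxE wi wj vi vj /letter_x /letter_y /=.
  rewrite !(mulr1, mulr0, addr0, add0r) => D11 D01 D10 D00.
  apply/matrixP => -[[|[|r]] lt_r] [[|[|c]] lt_c] //; rewrite mxE /=.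
  - by rewrite [RHS]D00; congr (D _ _); apply: val_inj.
  - by rewrite [RHS]D01; congr (D _ _); apply: val_inj.
  - by rewrite [RHS]D10; congr (D _ _); apply: val_inj.
  - by rewrite [RHS]D11; congr (D _ _); apply: val_inj.
apply: eq_from_tnth => q; move: wDv; rewrite D1 mul1mx => /matrixP wv.
by apply: letter_inj; [have := wv 0 q | have := wv 1 q]; rewrite !word_mxE.
Qed.

(** The matrix D is the inverse of the submatrix on the pivot columns i and j. Since
    that submatrix has determinant 1, the q-th column of D *m A consists of the
    minors of A on the column pairs (q, j) and (i, q), and every sign condition on
    it is a hypothesis on A. *)
Lemma nonneg_reduced (n : nat) (A : 'M['F_3]_(2, n)) : row_free A ->
  (forall p q : 'I_n, (p < q)%N -> pluecker A p q != -1) ->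
  exists2 w : n.-tuple 'I_5, reduced_word (map val w) & rowspan (word_mx w) = rowspan A.
Proof.
move=> freeA nnA; have [i [j [det_ij A0 Ai0]]] := first_columns freeA.
have plC p q : pluecker A p q = - pluecker A q p by rewrite /pluecker; ring.
have pp q : pluecker A q q = 0 by rewrite /pluecker; ring.
have lt_ij : (i < j)%N.
  rewrite ltnNge; apply: contra det_ij; rewrite leq_eqVlt => /orP[/eqP/val_inj <-|].
    by rewrite pp.
  by move=> /A0[a0 a1]; rewrite /pluecker a0 a1 mulr0 mul0r subr0.
have d1 : pluecker A i j = 1.
  by move: det_ij (nnA i j lt_ij); case: (F3P (pluecker A i j)) => -> //; rewrite eqxx.
pose D : 'M['F_3]_2 := \matrix_(r, c) if r == 0 then (if c == 0 then A 1 j else - A 0 j)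
                                      else (if c == 0 then - A 1 i else A 0 i).
have B0 q : (D *m A) 0 q = pluecker A q j by rewrite mulmx2E !mxE /pluecker /=; ring.
have B1 q : (D *m A) 1 q = pluecker A i q by rewrite mulmx2E !mxE /pluecker /=; ring.
have /fin_all_exists[f Df] (q : 'I_n) :
    exists a : 'I_5, letter_x a = (D *m A) 0 q /\ letter_y a = (D *m A) 1 q.
  apply: letter_exists; rewrite B0 B1; case: (ltngtP q j) => [lt_qj|lt_jq|/val_inj ->].
  - by rewrite Ai0 // eqxx /= nnA.
  - have := nnA j q lt_jq; rewrite plC eqr_oppLR opprK => -> /=.
    by rewrite (nnA i q (ltn_trans lt_ij lt_jq)) orbT.
  - by rewrite pp d1.
pose w := [tuple f q | q < n].
have wE : word_mx w = D *m A.
  apply/matrixP => r q; rewrite mxE tnth_mktuple; have [fx fy] := Df q.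
  case: r => [[|[|r]] lt_r] //=; rewrite ?fx ?fy; congr (fun_of_matrix _ _ _); exact: val_inj.
have detD : D 0 0 * D 1 1 - D 0 1 * D 1 0 = 1.
  by rewrite !mxE /= -d1 /pluecker; ring.
have plw p q : pluecker (word_mx w) p q = pluecker A p q by rewrite wE pluecker_mulmx detD mul1r.
have wi : tnth w i = 1%N :> nat.
  have := word_mxE w i; rewrite wE B0 B1 pp d1.
  by case: (tnth w i) => [[|[|[|[|[|]]]]] ? []].
have wj : tnth w j = 2%N :> nat.
  have := word_mxE w j; rewrite wE B0 B1 pp d1.
  by case: (tnth w j) => [[|[|[|[|[|]]]]] ? []].
have det_ok (p q : 'I_n) : (p < q)%N -> follows (tnth w p) (tnth w q)
    || ((tnth w p == 4 :> nat) && (tnth w q == 1 :> nat)).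
  by move=> lt_pq; rewrite -letter_det -pluecker_word plw nnA.
have red_w : reduced_word (map val w).
  apply/reducedP; split; [|by exists i|by exists j].
  move=> p q lt_pq; case/orP: (det_ok p q lt_pq) => // /andP[/eqP wp /eqP wq].
  (* Here column p is -e1 and a later column q is e1. Column j is e2: it is not
     after p because det (-e1, e2) = -1, nor before q because det (e2, e1) = -1. *)
  case: (ltngtP p j) => [/det_ok|lt_jp|/val_inj eq_pj].
  - by rewrite wp wj.
  - by have := det_ok j q (ltn_trans lt_jp lt_pq); rewrite wq wj.
  - by move: wp; rewrite eq_pj wj.
exists w => //; apply/eqP; rewrite eqEdim !dim_rowspan ?word_mx_free // leqnn andbT.
by rewrite rowspan_sub wE submxMl.
Qed.

Lemma card_Gr_nonneg_reduced (n : nat) : #|Gr_nonneg 'F_3 2 n| = word_count reduced_word n.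
Proof.
set W := [set w : n.-tuple 'I_5 | reduced_word (map val w)].
rewrite /word_count -/W -(card_in_imset (f := fun w : n.-tuple 'I_5 => rowspan (word_mx w)) (D := W)).
  apply: eq_card => V; apply/idP/imsetP => [|[w]]; last first.
    by rewrite inE => cw ->; apply: rowspan_word_nonneg.
  rewrite !inE => /andP[_ /existsP[A /and3P[freeA /eqP <- nnA]]].
  have [p q lt_pq|w cw <-] := @nonneg_reduced n A freeA.
    rewrite -ff_nonneg_F3.
    exact: ((minors_pluecker A (@ff_nonneg _)).1 nnA).
  by exists w; rewrite ?inE.
by move=> w v; rewrite !inE => cw cv; apply: word_mx_inj.
Qed.

(** * Counting reduced words *)

Lemma card_tuple_cons (T : finType) (n : nat) (P : pred (seq T)) :
  #|[set w : n.+1.-tuple T | P w]| = (\sum_(x : T) #|[set w : n.-tuple T | P (x :: w)]|)%N.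
Proof.
rewrite -sum1dep_card.
under [RHS]eq_bigr do rewrite -sum1dep_card.
rewrite pair_big_dep /=.
rewrite (reindex (fun p : T * n.-tuple T => [tuple of p.1 :: p.2])) //=.
exists (fun w : n.+1.-tuple T => (thead w, [tuple of behead w])) => [[x w]|w] _ /=.
  by congr (_, _); apply: val_inj.
by rewrite -tuple_eta.
Qed.

Lemma eq_word_count (P Q : pred (seq nat)) (n : nat) :
  P =1 Q -> word_count P n = word_count Q n.
Proof. by move=> eqPQ; apply: eq_card => w; rewrite !inE eqPQ. Qed.

Lemma word_count0 (P : pred (seq nat)) : word_count P 0 = P [::].
Proof.
rewrite /word_count; case: (boolP (P [::])) => P0.
  rewrite (eq_card (B := predT)) ?card_tuple // => w.
  by rewrite !inE (tuple0 w) P0.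
by apply: eq_card0 => w; rewrite !inE (tuple0 w) /= (negPf P0).
Qed.

Lemma word_countS (P : pred (seq nat)) (n : nat) :
  word_count P n.+1 = (\sum_(b < 5) word_count (fun s => P (val b :: s)) n)%N.
Proof. exact: (card_tuple_cons _ (fun w : seq 'I_5 => P (map val w))). Qed.

Lemma word_count_eq0 (P : pred (seq nat)) (n : nat) :
  P =1 xpred0 -> word_count P n = 0%N.
Proof. by move=> P0; apply: eq_card0 => w; rewrite !inE P0. Qed.

(** The possible continuations of a word whose current letter is a. *)
Definition tail_word (a : nat) (s : seq nat) : bool :=
  all (follows a) s && pairwise follows s.

Lemma tail_word_cons (a b : nat) (s : seq nat) :
  tail_word a (b :: s) =
    if b == 0%N then tail_word a s else (a <= b)%N && tail_word b s.
Proof.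
rewrite /tail_word /= {1}/follows; case: eqP => [->|_] /=.
  suff -> : all (follows 0) s by [].
  by apply/allP => c _; rewrite /follows leq0n orbT.
case: (leqP a b) => //= le_ab.
apply: andb_idl => /andP[/allP bs _]; apply/allP => c /bs.
by rewrite /follows => /orP[-> // | /(leq_trans le_ab) ->]; rewrite orbT.
Qed.

(** The next position is either 0, which keeps the current letter, or a letter
    b >= a, which becomes the current one. *)
Lemma tail_count_step (a n : nat) : (0 < a)%N ->
  word_count (tail_word a) n.+1 =
    (word_count (tail_word a) n
     + \sum_(b < 5 | (a <= b)%N) word_count (tail_word b) n)%N.
Proof.
move=> a_gt0; rewrite word_countS (bigD1 0) //=; congr addn.
  by apply: eq_word_count => s; rewrite tail_word_cons.
rewrite big_mkcond [RHS]big_mkcond; apply: eq_bigr => b _.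
case: (altP (b =P 0)) => [->|b0] /=; first by rewrite leqNgt a_gt0.
have {}b0 : (val b == 0%N) = false := negPf b0.
case: (leqP a b) => ab; last first.
  by apply: word_count_eq0 => s; rewrite tail_word_cons b0 leqNgt ab.
by apply: eq_word_count => s; rewrite tail_word_cons b0 ab.
Qed.

Lemma tail_count4 (n : nat) : (word_count (tail_word 4) n)%:R = 2%:R ^+ n :> rat.
Proof.
elim: n => [|n IH]; first by rewrite word_count0.
rewrite tail_count_step // big_mkcond !big_ord_recr big_ord0 /= !add0n natrD IH (exprS _ n).
by ring.
Qed.

Lemma tail_count3 (n : nat) :
  (word_count (tail_word 3) n)%:R = 2%:R ^+ n * (n%:R + 2%:R) / 2%:R :> rat.
Proof.
elim: n => [|n IH]; first by rewrite word_count0.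
rewrite tail_count_step // big_mkcond !big_ord_recr big_ord0 /= !add0n !natrD.
by rewrite IH tail_count4 (exprS _ n) -[n.+1%:R]natr1; field.
Qed.

Lemma tail_count2 (n : nat) :
  (word_count (tail_word 2) n)%:R
    = 2%:R ^+ n * (n%:R ^+ 2 + 7%:R * n%:R + 8%:R) / 8%:R :> rat.
Proof.
elim: n => [|n IH]; first by rewrite word_count0.
rewrite tail_count_step // big_mkcond !big_ord_recr big_ord0 /= !add0n !natrD.
by rewrite IH tail_count3 tail_count4 (exprS _ n) -[n.+1%:R]natr1; field.
Qed.

(** The possible continuations while the current letter is 1: the letter 2 has
    still to come, so that 3 and 4 cannot be the next nonzero letter. *)
Definition started_word (s : seq nat) : bool := tail_word 1 s && (2 \in s).

Lemma started_count (n : nat) :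
  (word_count started_word n)%:R
    = 2%:R ^+ n * (n%:R * (n%:R + 2%:R) * (n%:R + 7%:R)) / 48%:R :> rat.
Proof.
elim: n => [|n IH]; first by rewrite word_count0.
have step b : (0 < b)%N ->
    (fun s => started_word (b :: s)) =1 (fun s => tail_word b s && (2 \in b :: s)).
  by move=> b0 s; rewrite /started_word tail_word_cons -[b == _]negbK -lt0n b0.
have late b : (2 < b)%N -> word_count (fun s => started_word (b :: s)) n = 0%N.
  move=> b2; apply: word_count_eq0 => s; rewrite step ?inE ?(ltn_trans _ b2) //.
  rewrite (ltn_eqF b2) /=; apply/negP => /andP[/andP[/allP bs _] /bs].
  by rewrite /follows leqNgt b2.
rewrite word_countS !big_ord_recr big_ord0 /= (late 3) // (late 4) // add0n !addn0.
have -> : word_count (fun s => started_word (0%N :: s)) n = word_count started_word n.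
  by apply: eq_word_count => s; rewrite /started_word tail_word_cons inE.
have -> : word_count (fun s => started_word (1%N :: s)) n = word_count started_word n.
  by apply: eq_word_count => s; rewrite step // inE.
have -> : word_count (fun s => started_word (2 :: s)) n = word_count (tail_word 2) n.
  by apply: eq_word_count => s; rewrite step // inE eqxx andbT.
by rewrite !natrD IH tail_count2 (exprS _ n) -[n.+1%:R]natr1; field.
Qed.

(** The first nonzero letter of a reduced word is 1. *)
Lemma reduced_countS (n : nat) :
  word_count reduced_word n.+1 = (word_count reduced_word n + word_count started_word n)%N.
Proof.
have late b : (1 < b)%N -> word_count (fun s => reduced_word (b :: s)) n = 0%N.
  move=> b1; apply: word_count_eq0 => s; apply/negP => /and3P[/andP[/allP bs _]].
  by rewrite inE (ltn_eqF b1) /= => /bs; rewrite /follows leqNgt b1.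
rewrite word_countS !big_ord_recr big_ord0 /= (late 2) // (late 3) // (late 4) // add0n !addn0.
congr addn; apply: eq_word_count => s.
  rewrite /reduced_word !inE /=; suff -> : all (follows 0) s by [].
  by apply/allP => c _; rewrite /follows leq0n orbT.
Qed.

Definition grass_count (n : nat) : rat :=
  2%:R ^+ n * ((n%:R - 1) * n%:R * (n%:R + 4%:R)) / 48%:R.

Lemma reduced_count (n : nat) :
  (word_count reduced_word n)%:R = grass_count n.
Proof.
rewrite /grass_count.
elim: n => [|n IH]; first by rewrite word_count0 /= !(mulr0, mul0r).
by rewrite reduced_countS natrD IH started_count (exprS _ n) -[n.+1%:R]natr1; field.
Qed.

(** * Formal power series *)

Section Fps.
Variable R : comUnitRingType.
Implicit Types f g h : fps R.

Lemma fps_div_eq f g h : fps_coef g 0 \is a GRing.unit -> h * g = f -> f / g = h.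
Proof. by move=> Ug <-; rewrite mulrK. Qed.

Lemma fps_coefMC f c n : fps_coef (f * fpsC c) n = fps_coef f n * c.
Proof.
rewrite mulrC (_ : fps_coef _ n = \sum_(i < n.+1) fps_coef (fpsC c) i * fps_coef f (n - i)) //.
rewrite big_ord_recl /= subn0 big1 ?addr0 => [|i _]; first by rewrite mulrC.
by rewrite mul0r.
Qed.

Lemma fps_coefMX f n : fps_coef (f * fpsX) n = if n is m.+1 then fps_coef f m else 0.
Proof.
rewrite mulrC (_ : fps_coef _ n = \sum_(i < n.+1) fps_coef fpsX i * fps_coef f (n - i)) //.
rewrite big_ord_recl mul0r add0r; case: n => [|n]; first by rewrite big_ord0.
rewrite big_ord_recl /= mul1r subn1 /= big1 ?addr0 // => i _.
by rewrite mul0r.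
Qed.

Lemma fps_natE (k : nat) : k%:R = fpsC k%:R :> fps R.
Proof.
elim: k => [|k IH]; first by apply: fpsP => -[].
by rewrite -natr1 IH; apply: fpsP => -[|n] /=; rewrite -?natr1 // addr0.
Qed.

End Fps.

(** Multiplication by 1 - c x is a first-order difference on coefficients, so the
    fourth power below is four successive differences. *)
Lemma fps_linearM (c : nat) (f : fps rat) n :
  fps_coef (f * (1 - c%:R * fpsX)) n =
  fps_coef f n - (if n is m.+1 then c%:R * fps_coef f m else 0).
Proof.
rewrite mulrBr mulr1 mulrA (_ : fps_coef (_ - _) n = fps_coef f n - fps_coef (f * c%:R * fpsX) n) // fps_coefMX fps_natE.
by case: n => // n; rewrite fps_coefMC mulrC.
Qed.

Lemma grass_count_gf (k : nat) :
  fps_coef ((1 - fpsX) / (1 - 2%:R * fpsX) ^+ 4) k = grass_count k.+2.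
Proof.
rewrite (@fps_div_eq _ _ _ (Fps (fun k => grass_count k.+2))) //.
  have -> : fps_coef ((1 - 2%:R * fpsX) ^+ 4) 0 = 1 :> rat.
    by rewrite !exprSr expr0 !fps_linearM /= !subr0.
  by [].
rewrite !exprS expr0 mulr1 !mulrA; apply: fpsP => n.
rewrite !fps_linearM.
(* The four differences reach back to the coefficient of index n - 4, which
   exists only for n >= 4. *)
case: n => [|[|[|[|n]]]]; rewrite ?fps_linearM /= /grass_count.
1-4: by field.
by rewrite !(exprS _ _.+1); field.
Qed.

(** * Coefficients of the Chebyshev polynomials *)

Local Notation T := (chebyshevT rat).

(** For a fixed difference between degree and exponent this is a first-order
    recursion in k, whose inhomogeneous term has that difference lowered by 2. *)
Lemma coef_chebyshev (m k : nat) :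
  (T m.+2)`_k = (if k is j.+1 then 2%:R * (T m.+1)`_j else 0) - (T m)`_k.
Proof.
rewrite chebyshevTSS coefB -mulrA mulr_natl coefMn coefXM.
by case: k => [|k] /=; rewrite ?mul0rn // mulr_natl.
Qed.

(** The induction carries two consecutive degrees, as the recursion has order two. *)
Lemma chebyshev_degree (m k : nat) : (m < k)%N -> (T m)`_k = 0.
Proof.
suff: (m < k)%N -> (T m)`_k = 0 /\ forall k, (m.+1 < k)%N -> (T m.+1)`_k = 0.
  by move=> H /H[].
elim: m k => [|m IH] k ltk.
  rewrite chebyshevT0 coef1 chebyshevT1; case: k ltk => // k _; split=> // -[|[|j]] //.
  by rewrite coefX.
have [_ IH1] := IH m.+1 (ltnSn m); split; first exact: IH1.
case=> [|j] // ltj; rewrite coef_chebyshev IH1 //.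
by have [-> _] := IH j.+1 (ltn_trans (ltnSn _) (ltn_trans (ltnSn _) ltj)); rewrite mulr0 subr0.
Qed.

Lemma chebyshev_lead (k : nat) : (T k.+1)`_k.+1 = 2%:R ^+ k.
Proof.
elim: k => [|k IH]; first by rewrite chebyshevT1 coefX.
by rewrite coef_chebyshev IH chebyshev_degree // subr0 exprS.
Qed.

Lemma chebyshev_lead2 (k : nat) :
  (T k.+2)`_k = - (2%:R ^+ k * (k%:R + 2%:R) / 2%:R).
Proof.
elim: k => [|k IH]; first by rewrite coef_chebyshev chebyshevT0 coef1.
by rewrite coef_chebyshev IH chebyshev_lead (exprS _ k) -[k.+1%:R]natr1; field.
Qed.

Lemma chebyshev_lead4 (k : nat) :
  (T k.+4)`_k = 2%:R ^+ k * ((k%:R + 1) * (k%:R + 4%:R)) / 4%:R.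
Proof.
elim: k => [|k IH]; first by rewrite !coef_chebyshev chebyshevT0 coef1.
by rewrite coef_chebyshev IH chebyshev_lead2 (exprS _ k) -[k.+1%:R]natr1; field.
Qed.

Lemma chebyshev_lead6 (k : nat) : (T k.+4.+2)`_k = - grass_count k.+2.
Proof.
rewrite /grass_count; elim: k => [|k IH].
  by rewrite !coef_chebyshev chebyshevT0 coef1.
rewrite coef_chebyshev IH chebyshev_lead4 !(exprS _ k.+2) !(exprS _ k.+1) !(exprS _ k).
by rewrite -[k.+3%:R]natr1 -[k.+2%:R]natr1 -[k.+1%:R]natr1; field.
Qed.

Definition fps_poly (R : nzRingType) (p : {poly R}) : fps R := Fps (fun k => p`_k).

Lemma fps_poly_mulX (R : comNzRingType) (p : {poly R}) :
  fps_poly p * fpsX = fps_poly (p * 'X).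
Proof.
apply: fpsP => -[|k] /=; rewrite coefMX /=.
  by rewrite big_ord1 /= mulr0.
rewrite big_ord_recr big_ord_recr /= subnn subSnn /= mulr0 addr0 mulr1.
rewrite big1 ?add0r // => i _.
by rewrite subSn 1?ltnW // eqSS subn_eq0 leqNgt ltn_ord mulr0.
Qed.

(** The product of the right-hand side with the denominator is computed
    coefficientwise in t, where it is the recursion of the polynomials. *)
Lemma chebyshev_gf :
  (- (1 - fps2_t rat * fps2_x rat)) / (1 - 2%:R * fps2_t rat * fps2_x rat + fps2_t rat ^+ 2)
  = Fps (fun m => fps_poly (- T m)).
Proof.
set x := fps2_x rat; set t := fps2_t rat.
set G := Fps _.
have GX m : fps_coef (G * x) m = fps_poly (- T m * 'X).
  by rewrite /x fps_coefMC fps_poly_mulX.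
apply: fps_div_eq.
  have -> : 1 - 2%:R * t * x + t ^+ 2 = 1 + (t - 2%:R * x) * t by ring.
  rewrite (_ : fps_coef _ _ = 1 + fps_coef ((t - 2%:R * x) * t) 0) //.
  by rewrite fps_coefMX addr0 unitr1.
have -> : G * (1 - 2%:R * t * x + t ^+ 2) = G - 2%:R * (G * x) * t + G * t * t by ring.
have subE (f g : fps (fps rat)) m : fps_coef (f + g) m = fps_coef f m + fps_coef g m by [].
have oppE (f : fps (fps rat)) m : fps_coef (- f) m = - fps_coef f m by [].
apply: fpsP => m; rewrite !subE !oppE subE oppE -mulrA mulr_natl.
have dblE (f : fps (fps rat)) m' : fps_coef (f *+ 2) m' = fps_coef f m' *+ 2 by [].
rewrite dblE [t * x]mulrC !fps_coefMX.
case: m => [|[|m]]; rewrite ?fps_coefMX ?GX.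
- by apply: fpsP => k /=; rewrite chebyshevT0 coefN coef1; case: k => [|k] /=; ring.
- apply: fpsP => k /=.
  by rewrite chebyshevT0 chebyshevT1 mulNr mul1r !coefN coefX; case: k => [|k] /=; ring.
apply: fpsP => k /=; rewrite mulNr !coefN coef_chebyshev coefMX.
case: k => [|k] /=; ring.
Qed.

(** * Sums over the position of the first nonzero letter *)

(** The hockey-stick identity, by Pascal's rule. *)
Lemma sum_bin (i n k : nat) :
  \sum_(i.+1 <= j < n.+1) 'C(n - j, k)%:R = 'C(n - i, k.+1)%:R :> rat.
Proof.
case: (leqP n i) => [le_ni|lt_in].
  by rewrite big_geq // (eqP le_ni) bin0n.
have [m ->] : exists m, n = (i + m)%N by exists (n - i)%N; rewrite subnKC // ltnW.
rewrite addKn => {lt_in n}; elim: m i => [|m IH] i.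
  by rewrite addn0 big_geq // bin0n.
rewrite big_ltn; last lia.
by rewrite addnS -addSn IH subSS addKn binS natrD addrC.
Qed.

Lemma fsum_nat (F : nat -> rat) (n : nat) : (forall i, (n < i)%N -> F i = 0) ->
  \sum_(i \in [set i : nat | (1 <= i)%N]%classic) F i = \sum_(1 <= i < n.+1) F i.
Proof.
move=> F0; rewrite [RHS]fsbig_seq ?iota_uniq //; apply/esym/fsbig_widen.
  by move=> i /=; rewrite mem_index_iota => /andP[].
move=> i [/= i1 /negP]; rewrite mem_index_iota i1 /= -leqNgt; exact: F0.
Qed.

Lemma bin2_rat (m : nat) : 'C(m, 2)%:R = m%:R * (m%:R - 1) / 2%:R :> rat.
Proof.
elim: m => [|m IH]; first by rewrite bin0n !mul0r.
by rewrite binS bin1 natrD IH -[m.+1%:R]natr1; field.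
Qed.

Lemma bin3_rat (m : nat) :
  'C(m, 3)%:R = m%:R * (m%:R - 1) * (m%:R - 2%:R) / 6%:R :> rat.
Proof.
elim: m => [|m IH]; first by rewrite bin0n !mul0r.
by rewrite binS natrD IH bin2_rat -[m.+1%:R]natr1; field.
Qed.

Lemma pow2_sub (m k : nat) : (2%:R : rat) ^ (m%:Z - k%:Z) = 2%:R ^+ m / 2%:R ^+ k.
Proof. by rewrite expfzDr // -exprnN. Qed.

(** The term of index i counts the reduced words with first nonzero letter at
    position i. After that position, choosing where the letters 2, 3, 4 make their
    first appearance, with 3 or 4 possibly missing, leaves two choices at every
    other position: 0 or the current letter. *)
Lemma grass_count_binomial (n : nat) :
  grass_count n = \sum_(1 <= i < n.+1)
    (2%:R ^ (n%:Z - i%:Z - 3%:Z) * 'C(n - i, 3)%:R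
     + 2%:R ^ (n%:Z - i%:Z - 1%:Z) * 'C(n - i, 2)%:R
     + 2%:R ^ (n%:Z - i%:Z - 1%:Z) * 'C(n - i, 1)%:R).
Proof.
(* S m is the number of continuations of length m after an initial letter 1. *)
pose S (m : nat) : rat := 2%:R ^+ m * (m%:R * (m%:R + 2%:R) * (m%:R + 7%:R)) / 48%:R.
have -> : grass_count n = \sum_(0 <= m < n) S m.
  elim: n => [|n IH].
    by rewrite /grass_count big_geq // !(mulr0, mul0r).
  rewrite big_nat_recr //= -IH /grass_count /S (exprS _ n) -[n.+1%:R]natr1; by field.
rewrite big_nat_rev big_add1 /= add0n; apply: eq_big_nat => i /andP[_ lt_in].
rewrite (subzn lt_in) !pow2_sub bin1 bin2_rat bin3_rat /S; by field.
Qed.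

(** The nested sums choose the positions j < l < m, hence are binomial coefficients.
    The factor 2 of the second one is the choice between the letters 3 and 4. *)
Lemma grass_count_sums (n : nat) : grass_count n =
   \sum_(1 <= i < n.+1) \sum_(i.+1 <= j < n.+1)
        \sum_(j.+1 <= l < n.+1) \sum_(l.+1 <= m < n.+1)
          2%:R ^ (n%:Z - i%:Z - 3%:Z)
      + \sum_(1 <= i < n.+1) \sum_(i.+1 <= j < n.+1)
        \sum_(j.+1 <= l < n.+1)
          2%:R * 2%:R ^ (n%:Z - i%:Z - 2%:Z)
      + \sum_(1 <= i < n.+1) \sum_(i.+1 <= j < n.+1)
          2%:R ^ (n%:Z - i%:Z - 1%:Z).
Proof.
have sum0 j a : \sum_(j.+1 <= l < n.+1) a = a * 'C(n - j, 1)%:R :> rat.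
  by rewrite -sum_bin mulr_sumr; apply: eq_bigr => l _; rewrite bin0 mulr1.
have sum1 i j a : \sum_(j.+1 <= l < n.+1) a * 'C(n - l, i)%:R = a * 'C(n - j, i.+1)%:R :> rat.
  by rewrite -mulr_sumr sum_bin.
have powS i : 2%:R * 2%:R ^ (n%:Z - i%:Z - 2%:Z) = 2%:R ^ (n%:Z - i%:Z - 1%:Z) :> rat.
  rewrite -{1}[2%:R]expr1z -expfzDr //; congr (_ ^ _); ring.
rewrite grass_count_binomial !big_split /=; congr (_ + _ + _); apply: eq_bigr => i _.
- under eq_bigr => j _ do (under eq_bigr => l _ do rewrite sum0; rewrite sum1).
  by rewrite sum1.
- under eq_bigr => j _ do rewrite sum0 powS.
  by rewrite sum1.
- by rewrite sum0.
Qed.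

(** * The six expressions *)

Local Open Scope classical_set_scope.

Theorem theorem5p3 (n : nat) (hn : (2 <= n)%N) :
  let N : rat := #|Gr_nonneg 'F_3 2 n|%:R in
  let pow2 (e : int) : rat := 2%:R ^ e in
  let x : fps rat := fpsX in
  let X : fps (fps rat) := fps2_x rat in
  let t : fps (fps rat) := fps2_t rat in
  N = \sum_(1 <= i < n.+1) \sum_(i.+1 <= j < n.+1)
        \sum_(j.+1 <= l < n.+1) \sum_(l.+1 <= m < n.+1)
          pow2 (n%:Z - i%:Z - 3%:Z)
      + \sum_(1 <= i < n.+1) \sum_(i.+1 <= j < n.+1)
        \sum_(j.+1 <= l < n.+1)
          2%:R * pow2 (n%:Z - i%:Z - 2%:Z)
      + \sum_(1 <= i < n.+1) \sum_(i.+1 <= j < n.+1)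
          pow2 (n%:Z - i%:Z - 1%:Z)
  /\
  N = \sum_(i \in [set i : nat | (1 <= i)%N])
        pow2 (n%:Z - i%:Z - 3%:Z) * 'C(n - i, 3)%:R
      + \sum_(i \in [set i : nat | (1 <= i)%N])
        pow2 (n%:Z - i%:Z - 1%:Z) * 'C(n - i, 2)%:R
      + \sum_(i \in [set i : nat | (1 <= i)%N])
        pow2 (n%:Z - i%:Z - 1%:Z) * 'C(n - i, 1)%:R
  /\
  N = pow2 (n%:Z - 4%:Z) * (n%:R - 1) * n%:R * (n%:R + 4%:R) / 3%:R
  /\
  N = fps_coef ((1 - x) / (1 - 2%:R * x) ^+ 4) (n - 2)
  /\
  N = (- chebyshevT rat (n + 4))`_(n - 2)
  /\
  N = fps_coef2 (- (1 - t * X) / (1 - 2%:R * t * X + t ^+ 2)) (n - 2) (n + 4).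
Proof.
move=> N pow2 x X t.
have N_E : N = grass_count n by rewrite /N card_Gr_nonneg_reduced reduced_count.
have n2 : (n - 2).+2 = n by lia.
split; first by rewrite N_E grass_count_sums.
have far i k : (n < i)%N -> 'C(n - i, k.+1)%:R = 0 :> rat.
  by move=> /ltnW le_ni; rewrite (eqP le_ni) bin0n.
split.
  rewrite N_E grass_count_binomial !big_split /=.
  by congr (_ + _ + _); rewrite (@fsum_nat _ n) // => i lt_ni; rewrite far // mulr0.
split.
  rewrite N_E /grass_count /pow2 pow2_sub; by field.
split; first by rewrite N_E grass_count_gf n2.
have N_T : N = (- chebyshevT rat (n + 4))`_(n - 2).
  have -> : (n + 4)%N = (n - 2).+4.+2 by lia.
  by rewrite coefN chebyshev_lead6 opprK n2.
split=> //.
by rewrite /X /t chebyshev_gf.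
Qed.
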